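(* Let $F \subseteq K \subseteq L$ be a tower of fields with $L/F$ finite and separable. Suppose $K$ contains a primitive $n$-th root of unity $\omega$ and that $L/K$ is an $n$-Kummer extension. Write $\mathrm{Gal}(L/K)=\langle\eta_1\rangle\cdots\langle\eta_r\rangle$ as an internal direct product of cyclic subgroups with $\eta_i$ of order $n_i$ (so each $n_i$ divides $n$), and for each $i$ let $\alpha_i\in K$ be such that the fixed field $L_i$ of $\langle\eta_1\rangle\cdots\langle\eta_{i-1}\rangle\langle\eta_{i+1}\rangle\cdots\langle\eta_r\rangle$ equals $K(\sqrt[n_i]{\alpha_i})$, with $\mathrm{Gal}(L_i/K)=\langle \eta_i\rangle$; thus $L=K(\sqrt[n_1]{\alpha_1},\dots,\sqrt[n_r]{\alpha_r})$. Let $K^c\subseteq L^c$ be the Galois closures of $K/F$ and $L/F$, let $\Omega=\mathrm{Hom}_F(K,K^c)$ with the left action of $\mathrm{Gal}(K^c/F)$ by composition, and let $\varepsilon(\rho)=\rho|_{K^c}$ for $\rho\in\mathrm{Gal}(L^c/F)$. Put $\omega_j=\omega^{n/n_j}$. For each $j$ and each element $\beta$ of the form $\tau(\alpha_j)$ with $\tau\in\Omega$, fix an $n_j$-th root $\sqrt[n_j]{\beta}\in L^c$ of $\beta$. For $\rho\in\mathrm{Gal}(L^c/F)$, $\tau\in\Omega$ and $j\in\{1,\dots,r\}$, let $\chi(\rho,\tau,\alpha_j)\in\mathbb{Z}/n_j\mathbb{Z}$ be the element satisfying $$\tau(\omega_j)^{\chi(\rho,\tau,\alpha_j)}=\frac{\rho\left(\sqrt[n_j]{\rho^{-1}(\tau(\alpha_j))}\right)}{\sqrt[n_j]{\tau(\alpha_j)}},$$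 and define $\sigma_\rho\colon\Omega\to\mathrm{Gal}(L/K)$ by $\sigma_\rho(\tau)=\eta_1^{\chi(\rho,\tau,\alpha_1)}\circ\cdots\circ\eta_r^{\chi(\rho,\tau,\alpha_r)}$. Then the map $$\varphi\colon \mathrm{Gal}(L^c/F)\longrightarrow \mathrm{Gal}(L/K)\wr_\Omega\mathrm{Gal}(K^c/F),\qquad \rho\longmapsto(\sigma_\rho,\varepsilon(\rho))$$ is an injective group homomorphism; in particular $\mathrm{Gal}(L^c/F)$ embeds into $\mathrm{Gal}(L/K)\wr_\Omega\mathrm{Gal}(K^c/F)$.
   Context: An extension $L/K$ is an $n$-Kummer extension if it is Galois with abelian Galois group of exponent dividing $n$. A primitive $n$-th root of unity is an element of multiplicative order exactly $n$. Note $\rho^{-1}(\tau(\alpha_j))=((\rho|_{K^c})^{-1}\circ\tau)(\alpha_j)$ is again of the form $\tau'(\alpha_j)$ with $\tau'\in\Omega$. Wreath products: for groups $N,H$ and a set $\Omega$ with a left action of $H$, let $N^{\Omega}$ be the group of functions $\Omega\to N$ under pointwise multiplication and $\theta_h(f)(x)=f(h^{-1}\cdot x)$; $N\wr_\Omega H=N^\Omega\rtimes_\theta H$ is the set of pairs $(f,h)$ with product $(f_1,h_1)(f_2,h_2)=(f_1\,\theta_{h_1}(f_2),h_1h_2)$. *)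

(* Defs.v *)
From HB Require Import structures.
From mathcomp Require Import all_boot all_order all_algebra.
From mathcomp Require Import all_fingroup all_solvable all_field.

Set Implicit Arguments.
Unset Strict Implicit.
Unset Printing Implicit Defensive.

Import GRing.Theory.
Local Open Scope ring_scope.

Record left_action (H : finGroupType) (X : finType) := LeftAction {
  lact :> H -> X -> X;
  lact1 : forall x, lact 1%g x = x;
  lactM : forall g h x, lact (g * h)%g x = lact g (lact h x)
}.

Definition wreath (N H : finGroupType) (X : finType) (to : left_action H X) :
  Type := ({ffun X -> N} * H)%type.

Section Wreath.

Variables (N H : finGroupType) (X : finType) (to : left_action H X).

Definition wreath_theta (h : H) (f : {ffun X -> N}) : {ffun X -> N} :=
  [ffun x => f (to h^-1%g x)].

Definition wreath_mul (p q : wreath N to) : wreath N to :=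
  ([ffun x => (p.1 x * wreath_theta p.2 q.1 x)%g], (p.2 * q.2)%g).

Definition wreath_one : wreath N to := ([ffun => 1%g], 1%g).

Definition wreath_inv (p : wreath N to) : wreath N to :=
  (wreath_theta p.2^-1%g [ffun x => (p.1 x)^-1%g], p.2^-1%g).

Fact wreath_mulA : associative wreath_mul.
Proof.
move=> p q s; congr pair; last exact: mulgA.
by apply/ffunP=> x; rewrite !ffunE /= invMg lactM mulgA.
Qed.

Fact wreath_mul1 : left_id wreath_one wreath_mul.
Proof.
move=> [f h]; congr pair; last exact: mul1g.
by apply/ffunP=> x; rewrite !ffunE /= invg1 lact1 mul1g.
Qed.

Fact wreath_mulV : left_inverse wreath_one wreath_inv wreath_mul.
Proof.
move=> [f h]; congr pair; last exact: mulVg.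
by apply/ffunP=> x; rewrite !ffunE /= mulVg.
Qed.

HB.instance Definition _ := Finite.copy (wreath N to) ({ffun X -> N} * H)%type.
HB.instance Definition _ :=
  Finite_isGroup.Build (wreath N to) wreath_mulA wreath_mul1 wreath_mulV.

End Wreath.

Section GaloisGroups.

Variables (F : fieldType) (M : splittingFieldType F).
Implicit Types (K L E : {subfield M}).

(* In the library group on [gal_of E] the product [x * y] applies [x] first   *)
(* (see [galM]).  [gal_group E K] has the elements of ['Gal(E / K)], but its  *)
(* product is composition of maps: see [gal_groupM].                          *)
Definition gal_group E K : Type := [subg 'Gal(E / K)].

Coercion gal_group_val E K (x : gal_group E K) : gal_of E := sgval x.

Section Group.

Variables E K : {subfield M}.

Definition gal_comp (x y : gal_group E K) : gal_group E K :=
  ((y : [subg 'Gal(E / K)]) * x)%g.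

Definition gal_comp1 : gal_group E K := (1 : [subg 'Gal(E / K)])%g.

Definition gal_compV (x : gal_group E K) : gal_group E K :=
  ((x : [subg 'Gal(E / K)])^-1)%g.

Fact gal_compA : associative gal_comp.
Proof. by move=> x y z; rewrite /gal_comp mulgA. Qed.

Fact gal_comp1l : left_id gal_comp1 gal_comp.
Proof. by move=> x; rewrite /gal_comp mulg1. Qed.

Fact gal_compVl : left_inverse gal_comp1 gal_compV gal_comp.
Proof. by move=> x; rewrite /gal_comp mulgV. Qed.

HB.instance Definition _ := Finite.copy (gal_group E K) [subg 'Gal(E / K)].
HB.instance Definition _ :=
  Finite_isGroup.Build (gal_group E K) gal_compA gal_comp1l gal_compVl.

Lemma gal_groupM (x y : gal_group E K) (a : M) :
  a \in E -> ((x * y)%g : gal_group E K) a = x (y a).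
Proof. exact: galM. Qed.

Lemma gal_group1 (a : M) : (1%g : gal_group E K) a = a.
Proof. exact: gal_id. Qed.

(* [x] seen as an automorphism of the [F]-algebra [subvs_of E] *)
Section Subvs.

Variable x : gal_group E K.

Definition gal_fun (u : subvs_of E) : subvs_of E := vsproj E (x (vsval u)).

Lemma val_gal_fun u : vsval (gal_fun u) = x (vsval u).
Proof. by rewrite vsprojK // memv_gal // subvsP. Qed.

Fact gal_fun_is_linear : linear gal_fun.
Proof.
move=> c u v; apply: val_inj.
by rewrite /= [LHS]val_gal_fun !linearP /= -!val_gal_fun.
Qed.

Fact gal_fun_is_monoid_morphism : monoid_morphism gal_fun.
Proof.
split=> [|u v]; apply: val_inj; rewrite /= [LHS]val_gal_fun.
  by rewrite algid1 !rmorph1.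
by rewrite /= rmorphM /= -!val_gal_fun.
Qed.

HB.instance Definition _ :=
  GRing.isLinear.Build F (subvs_of E) (subvs_of E) _ gal_fun gal_fun_is_linear.
HB.instance Definition _ :=
  GRing.isMonoidMorphism.Build (subvs_of E) (subvs_of E) gal_fun
    gal_fun_is_monoid_morphism.

Definition gal_ahom : 'AEnd(subvs_of E) := linfun_ahom gal_fun.

Lemma val_gal_ahom u : vsval (gal_ahom u) = x (vsval u).
Proof. by rewrite /= lfunE val_gal_fun. Qed.

End Subvs.

End Group.

(* [Hom_F(K, E)]; it is finite because [M] is a splitting field over [F] *)
Definition hom_over K E : Type := 'AHom(subvs_of K, subvs_of E).

Section HomOver.

Variables K E : {subfield M}.

HB.instance Definition _ :=
  Choice.copy (hom_over K E) 'AHom(subvs_of K, subvs_of E).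

Definition hom_over_enum : seq (hom_over K E) :=
  pmap insub [seq (linfun (vsproj E) \o g \o linfun (vsval : subvs_of K -> M))%VF
             | g : 'AEnd(M) <- sval (enum_AEnd M)].

Fact mem_hom_over_enum (f : hom_over K E) : f \in hom_over_enum.
Proof.
pose h (x : M) : M := vsval (f (vsproj K x)).
have h_lin : linear h by move=> c x y; rewrite /h !linearP.
pose hL : {linear M -> M} := HB.pack h (GRing.isLinear.Build F M M _ h h_lin).
have hE (u : subvs_of K) : linfun hL (vsval u) = vsval (f u).
  by rewrite lfunE /= /h vsvalK.
have homh : kHom 1 K (linfun hL).
  rewrite k1HomE; apply/ahom_inP; split=> [x y Kx Ky|].
    have [-> ->] : x = vsval (vsproj K x) /\ y = vsval (vsproj K y).
      by rewrite !vsprojK.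
    by rewrite -[vsval _ * vsval _]rmorphM !hE !rmorphM.
  by rewrite -[X in linfun hL X](rmorph1 (vsval : subvs_of K -> M)) hE !rmorph1.
have [g Dg] := kHom_to_AEnd homh.
rewrite /hom_over_enum mem_pmap; apply/mapP.
exists (val f); last by rewrite valK.
apply/mapP; exists g; first exact: svalP (enum_AEnd M) g.
by apply/lfunP=> u; rewrite !comp_lfunE !lfunE /= -Dg ?subvsP // hE vsvalK.
Qed.

HB.instance Definition _ := Countable.copy (hom_over K E)
  (can_type (fun f => erefl : val (SeqSub (mem_hom_over_enum f)) = f)).
HB.instance Definition _ := isFinite.Build (hom_over K E)
  (pcan_enumP (can_pcan
    (fun f => erefl : val (SeqSub (mem_hom_over_enum f)) = f))).

Definition hom_comp (x : gal_group E 1) (tau : hom_over K E) : hom_over K E :=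
  (gal_ahom x \o tau)%AF.

Lemma val_hom_comp x tau u : vsval (hom_comp x tau u) = x (vsval (tau u)).
Proof. by rewrite /= comp_lfunE val_gal_ahom. Qed.

Fact hom_comp1 tau : hom_comp 1%g tau = tau.
Proof.
apply/val_inj/lfunP=> u; apply: val_inj.
by rewrite [LHS]val_hom_comp gal_group1.
Qed.

Fact hom_compM x y tau : hom_comp (x * y)%g tau = hom_comp x (hom_comp y tau).
Proof.
apply/val_inj/lfunP=> u; apply: val_inj.
by rewrite [LHS]val_hom_comp [RHS]val_hom_comp val_hom_comp gal_groupM ?subvsP.
Qed.

Definition hom_action : left_action (gal_group E 1) (hom_over K E) :=
  LeftAction hom_comp1 hom_compM.

End HomOver.

(* [E] is the Galois closure of [K] over the base field [F], which is [1%AS]  *)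
(* as a subfield of [M]                                                       *)
Definition is_galois_closure K E : Prop :=
  [/\ galois 1 E, (K <= E)%VS &
      forall E' : {subfield M}, galois 1 E' -> (K <= E')%VS -> (E <= E')%VS].

Definition kummer_ext (n : nat) K L : bool :=
  [&& galois K L, abelian 'Gal(L / K) & (exponent 'Gal(L / K) %| n)%N].

(* [subg] only casts to the subtype: see [restr_galE] *)
Definition restr_gal (Lc Kc : {subfield M}) (rho : gal_group Lc 1) :
  gal_group Kc 1 := subg 'Gal(Kc / 1) (normalField_cast Kc rho).

Lemma restr_galE (Lc Kc : {subfield M}) (rho : gal_group Lc 1) (a : M) :
  galois 1 Kc -> (Kc <= Lc)%VS -> a \in Kc -> restr_gal Kc rho a = rho a.
Proof.
case/and3P=> _ _ nKc sKcLc Kca.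
have in_gal E (x : gal_of E) : x \in 'Gal(E / 1)%g.
  by rewrite gal_kHom ?sub1v ?k1AHom.
have -> : restr_gal Kc rho = normalField_cast Kc rho :> gal_of Kc.
  exact: subgK (in_gal _ _).
by rewrite (normalField_cast_eq _ nKc) ?in_gal // sub1v.
Qed.

Section KummerMap.

Variables (K L Kc Lc : {subfield M}) (n r : nat).
Variables (omega : subvs_of K) (eta : 'I_r -> gal_of L).
Variables (alpha : 'I_r -> subvs_of K).
(* [rt j b] is a chosen [#[eta j]]-th root of [b] *)
Variable rt : 'I_r -> M -> M.

Definition compl_field (i : 'I_r) : {subfield M} :=
  [aspace of fixedField (\prod_(j < r | j != i) <[eta j]>)%g].

Definition chi_spec (rho : gal_group Lc 1) (tau : hom_over K Kc) (j : 'I_r)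
    (c : 'I_#[eta j]%g) : bool :=
  vsval (tau (omega ^+ (n %/ #[eta j]%g))) ^+ c ==
    rho (rt j ((rho^-1%g : gal_group Lc 1) (vsval (tau (alpha j)))))
      / rt j (vsval (tau (alpha j))).

(* Residues mod [m] are represented by ['I_m], because ['Z_m] is not the ring *)
(* of integers mod [m] when [m = 1].  Over a Kummer extension the default     *)
(* value is not used when [alpha j != 0]; when [alpha j = 0], so that the     *)
(* quotient above makes no sense, [#[eta j] = 1] and ['I_1] is a singleton.   *)
Definition chi (rho : gal_group Lc 1) (tau : hom_over K Kc) (j : 'I_r) :
  'I_#[eta j]%g :=
  odflt (Ordinal (order_gt0 (eta j))) [pick c | chi_spec rho tau c].

Definition kummer_sigma (rho : gal_group Lc 1) (tau : hom_over K Kc) :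
    gal_group L K :=
  (\prod_(j < r) (subg 'Gal(L / K) (eta j) : gal_group L K) ^+ chi rho tau j)%g.

Definition kummer_phi (rho : gal_group Lc 1) :
    wreath (gal_group L K) (hom_action K Kc) :=
  ([ffun tau => kummer_sigma rho tau], restr_gal Kc rho).

End KummerMap.
End GaloisGroups.

Arguments kummer_phi {F M K L Kc Lc} n {r} omega eta alpha rt rho.

(* Main.v *)
(* Applying [x] to the equation defining [chi y (x^-1 tau) j] shows that      *)
(* [chi (x y) tau j = chi x tau j + chi y (x^-1 tau) j], and ['Gal(L / K)] is *)
(* abelian, so the map is a morphism.  An element [rho] of its kernel fixes   *)
(* [Kc] and all the chosen roots, hence also all [#[eta j]]-th roots of the   *)
(* conjugates of the [alpha j], because the required roots of unity are in    *)
(* [Kc].  These roots and [Kc] generate a field containing [g L] for each     *)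
(* [g], so every conjugate of [rho] fixes [L] and therefore [rho = 1].        *)

From HB Require Import structures.
Require Import Defs.
From mathcomp Require Import all_boot all_order all_algebra.
From mathcomp Require Import all_fingroup all_solvable all_field.

Set Implicit Arguments.
Unset Strict Implicit.
Unset Printing Implicit Defensive.

Import GRing.Theory.
Local Open Scope ring_scope.

(** For nonzero [alpha j], the numerator and denominator in [chi_spec] are both [#[eta j]]-th roots
    of [tau (alpha j)], because [rho^-1 tau] is again in [hom_over K Kc]. Their quotient is thus a
    unique power of a primitive root of unity ([chi_spec_unique]). Comparing these quotients for a
    product makes [chi] a cocycle modulo [#[eta j]] ([chiM]), which is the twisted multiplication of
    the wreath product ([kummer_phiM]). Injectivity is [kummer_phi_ker]: an element of the kernel
    fixes [Kc] and the chosen roots ([kummer_phi1P]), hence the image under each [g] of the Kummer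
    generators, hence of all of [L] ([sub_compl_field]). This forces it to be trivial on the closure
    [Lc] ([galois_closure_faithful]). *)

(** * Coordinates in internal direct products *)

Section BigDprod.

Local Open Scope group_scope.

Variables (gT : finGroupType) (I : finType) (A : I -> {set gT}).
Variable G : {group gT}.
Hypothesis defG : \big[dprod/1]_i A i = G.

Lemma bigdprod_compl (i : I) :
  exists2 H : {group gT},
    \big[dprod/1]_(j | j != i) A j = H & A i :&: H = 1.
Proof.
move: defG; rewrite (bigD1 i) //= => /dprodP[[B H -> ->] _ _ tiBH].
by exists H.
Qed.

(** Coordinates are unique, and lying in the complement of [A i] provides a decomposition whose
    [i]-th coordinate is trivial. *)
Lemma bigdprod_cap_compl (x : gT) :
  x \in G -> (forall i, x \in \prod_(j | j != i) A j) -> x = 1.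
Proof.
move=> Gx Hx; have [c [_ Dc uniq_c]] := mem_bigdprod defG Gx.
rewrite Dc; apply: big1 => i _; have [H defH _] := bigdprod_compl i.
have Hi_x : x \in H by rewrite -(bigdprodW defH).
have [d [Ad Dx _]] := mem_bigdprod defH Hi_x.
pose e j := if j == i then 1 else d j.
rewrite -(uniq_c e) //; first by rewrite /e eqxx.
- move=> j _; rewrite /e; case: eqVneq => [-> | /Ad//].
  by move: defG; rewrite (bigD1 i) //= => /dprodP[[B C -> _] _ _ _].
- rewrite Dx [LHS]big_mkcond; apply: eq_bigr => j _.
  by rewrite /e; case: eqVneq.
Qed.

End BigDprod.

Lemma bigdprod_cycle_coord (gT : finGroupType) (I : finType) (a : I -> gT)
    (G : {group gT}) (c : forall i, 'I_#[a i]%g) :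
  \big[dprod/1%g]_i <[a i]>%g = G -> (\prod_i a i ^+ c i)%g = 1%g ->
  forall i, c i = 0%N :> nat.
Proof.
move=> defG a1 i; have [d [_ _ uniq_d]] := mem_bigdprod defG (group1 G).
have /eqP : (a i ^+ c i = 1)%g.
  rewrite (uniq_d (fun j => a j ^+ c j)%g) // => [|j _]; last exact: mem_cycle.
  by rewrite -(uniq_d (fun=> 1%g)) // big1.
by rewrite -order_dvdn /dvdn modn_small // => /eqP.
Qed.

Lemma abelian_prodgM (gT : finGroupType) (I : finType) (G : {group gT})
    (a b : I -> gT) :
    abelian G -> (forall i, a i \in G) -> (forall i, b i \in G) ->
  (\prod_i (a i * b i) = (\prod_i a i) * \prod_i b i)%g.
Proof.
move=> /centsP abG Ga Gb.
(* Moving [b i] past the partial product of the [a] requires that product to lie in [G], so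
   membership is carried through the induction. *)
suff [] : (\prod_i a i)%g \in G /\
  (\prod_i (a i * b i) = (\prod_i a i) * \prod_i b i)%g by [].
apply: (big_rec3 (fun x y z => x \in G /\ z = (x * y)%g)).
  by rewrite group1 mulg1.
move=> i x y _ _ [Gx ->].
rewrite groupM //; split=> //.
by rewrite !mulgA -(mulgA (a i)) (abG _ (Gb i) _ Gx) mulgA.
Qed.

(** * Galois groups under composition, and Galois closures *)

Section GalGroup.

Variables (F : fieldType) (M : splittingFieldType F).
Implicit Types (K L E : {subfield M}).

Lemma mem_gal1 E (x : gal_of E) : x \in 'Gal(E / 1)%g.
Proof. by rewrite gal_kHom ?sub1v ?k1AHom. Qed.

Lemma gal_group_eqP E K (x y : gal_group E K) :
  {in E, (x : gal_of E) =1 (y : gal_of E)} -> x = y.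
Proof. by move=> eqxy; apply/val_inj/eqP/gal_eqP. Qed.

Lemma gal_groupK E K (x : gal_group E K) a :
  a \in E -> x ((x^-1%g : gal_group E K) a) = a.
Proof. by move=> Ea; rewrite -gal_groupM // mulgV gal_group1. Qed.

Lemma gal_group_val_inj E K : injective (@gal_group_val F M E K).
Proof. exact: val_inj. Qed.

Lemma gal_group_valM E K (x y : gal_group E K) :
  gal_group_val (x * y)%g = (gal_group_val y * gal_group_val x)%g.
Proof. by []. Qed.

Lemma gal_group_valX E K (x : gal_group E K) m :
  gal_group_val (x ^+ m)%g = (gal_group_val x ^+ m)%g.
Proof. by elim: m => // m IHm; rewrite expgSr expgS -IHm. Qed.

(* Since [gal_group] and [gal_of] have opposite products, this needs the      *)
(* factors to commute.                                                        *)
Lemma gal_group_val_prod E K (I : finType) (f : I -> gal_group E K) :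
  abelian 'Gal(E / K) ->
  gal_group_val (\prod_i f i)%g = (\prod_i gal_group_val (f i))%g.
Proof.
move=> /centsP abG.
elim/big_rec2: _ => // i y x _ <-; apply: abG; exact: subgP.
Qed.

(** Since [Kc] is normal over the base field, [g] restricts to [Kc]; composing with the inclusion of
    [K] gives [tau]. *)
Lemma hom_over_restr (K Kc Lc : {subfield M}) (g : gal_group Lc 1) :
    galois 1 Kc -> (K <= Kc)%VS -> (Kc <= Lc)%VS ->
  exists tau : hom_over K Kc, forall u, vsval (tau u) = g (vsval u).
Proof.
move=> galKc sKKc sKcLc; pose i (u : subvs_of K) := vsproj Kc (vsval u).
have iE u : vsval (i u) = vsval u by rewrite vsprojK ?(subvP sKKc) ?subvsP.
have i_lin : linear i.
  by move=> c u v; apply: val_inj; rewrite /= [LHS]iE !linearP /= !iE.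
have i_mul : monoid_morphism i.
  split=> [|u v]; apply: val_inj; rewrite /= [LHS]iE ?algid1 ?rmorph1 //.
  by rewrite rmorphM /= !iE.
pose iL : {lrmorphism subvs_of K -> subvs_of Kc} := HB.pack i
  (GRing.isLinear.Build F _ _ _ i i_lin)
  (GRing.isMonoidMorphism.Build _ _ i i_mul).
exists (hom_comp (restr_gal Kc g) (linfun_ahom iL)) => u.
rewrite val_hom_comp (_ : linfun_ahom iL u = i u); last exact: (lfunE iL u).
rewrite iE restr_galE //.
by rewrite (subvP sKKc) ?subvsP.
Qed.

(* The fixed field of the normal closure of [rho] is Galois over the base     *)
(* field and contains [L].                                                    *)
Lemma galois_closure_faithful (L Lc : {subfield M}) (rho : gal_group Lc 1) :
    is_galois_closure L Lc ->
    (forall (g : gal_group Lc 1) a, a \in L -> rho (g a) = g a) ->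
  rho = 1%g.
Proof.
case=> galLc sLLc minLc rho_fix.
pose N := <<class_support [set gal_group_val rho] 'Gal(Lc / 1)>>%G.
have nN : (N <| 'Gal(Lc / 1))%g.
  apply/andP; split; first by apply/subsetP=> x _; exact: mem_gal1.
  exact: norms_gen (class_support_norm _ _).
have sLN : (L <= fixedField N)%VS.
  rewrite -galois_connection // gen_subG.
  apply/subsetP=> _ /imset2P[_ g /set1P-> Gg ->].
  rewrite gal_kHom //; apply/kAHomP => a La; have Lca := subvP sLLc a La.
  (* The library conjugate of [rho] by [g] applies [g^-1] first, so the hypothesis is used at
     [g^-1]. *)
  have gVg : gal_group_val (subg 'Gal(Lc / 1) g^-1)%g = (g^-1)%g.
    by rewrite /gal_group_val subgK ?groupV.
  rewrite conjgE !galM ?memv_gal //.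
  have := rho_fix (subg 'Gal(Lc / 1) g^-1)%g a La; rewrite gVg => ->.
  by rewrite -galM // mulVg gal_id.
have sLcN := minLc _ (normal_fixedField_galois galLc nN) sLN.
(* [rho] is one of the generators of [N], whose fixed field contains [Lc]. *)
apply: gal_group_eqP => a Lca; rewrite gal_id.
have [_ ] := mem_fixedFieldP (subvP sLcN a Lca); apply.
apply: mem_gen; apply/imset2P; exists (gal_group_val rho) 1%g;
  by rewrite ?set11 ?group1 ?conjg1.
Qed.

End GalGroup.

(** * Restriction to a Galois subfield *)

Section Restriction.

Variables (F : fieldType) (M : splittingFieldType F) (Kc Lc : {subfield M}).
Hypotheses (galKc : galois 1 Kc) (sKcLc : (Kc <= Lc)%VS).

Lemma restr_galM (x y : gal_group Lc 1) :
  restr_gal Kc (x * y)%g = (restr_gal Kc x * restr_gal Kc y)%g.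
Proof.
apply: gal_group_eqP => a Ka; have La := subvP sKcLc a Ka.
rewrite gal_groupM // !restr_galE // ?gal_groupM //.
by rewrite -(restr_galE y galKc) // memv_gal.
Qed.

Lemma restr_gal1 : restr_gal Kc (1 : gal_group Lc 1)%g = 1%g.
Proof. by apply: (mulgI (restr_gal Kc (1 : gal_group Lc 1)%g)); rewrite -restr_galM !mulg1. Qed.

Lemma restr_galV (x : gal_group Lc 1) :
  restr_gal Kc x^-1%g = (restr_gal Kc x)^-1%g.
Proof.
by apply: (mulgI (restr_gal Kc x)); rewrite -restr_galM !mulgV restr_gal1.
Qed.

Lemma val_hom_comp_restr (K : {subfield M}) (x : gal_group Lc 1)
    (tau : hom_over K Kc) u :
  vsval (hom_comp (restr_gal Kc x) tau u) = x (vsval (tau u)).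
Proof. by rewrite val_hom_comp restr_galE ?subvsP. Qed.

End Restriction.

(** * The Kummer cocycle and the map into the wreath product *)

Section KummerEmbedding.

Variables (F : fieldType) (M : splittingFieldType F).
Variables (K L Kc Lc : {subfield M}) (n r : nat) (omega : subvs_of K).
Variables (eta : 'I_r -> gal_of L) (alpha : 'I_r -> subvs_of K).
Variable rt : 'I_r -> M -> M.
Hypotheses (sKL : (K <= L)%VS).
Hypotheses (closK : is_galois_closure K Kc) (closL : is_galois_closure L Lc).
Hypothesis prim_omega : n.-primitive_root omega.
Hypothesis kummerL : kummer_ext n K L.
Hypothesis dprod_eta : \big[dprod/1%g]_(i < r) <[eta i]>%g = 'Gal(L / K)%g.
Hypothesis gen_alpha : forall i : 'I_r, exists2 a : M,
  a ^+ #[eta i]%g = vsval (alpha i) &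
  compl_field eta i = <<K; a>>%VS :> {vspace M}.
Hypothesis root_rt : forall (j : 'I_r) (tau : hom_over K Kc),
  rt j (vsval (tau (alpha j))) \in Lc /\
  rt j (vsval (tau (alpha j))) ^+ #[eta j]%g = vsval (tau (alpha j)).

Local Notation chi := (chi n omega eta alpha rt).
Local Notation kummer_phi :=
  (@kummer_phi F M K L Kc Lc n r omega eta alpha rt).
Local Notation root_of_unity tau j :=
  (vsval (tau (omega ^+ (n %/ #[eta j]%g)))).

Let galKc : galois 1 Kc. Proof. by case: closK. Qed.
Let galLc : galois 1 Lc. Proof. by case: closL. Qed.
Let sKKc : (K <= Kc)%VS. Proof. by case: closK. Qed.
Let sLLc : (L <= Lc)%VS. Proof. by case: closL. Qed.
Let sKcLc : (Kc <= Lc)%VS.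
Proof. by case: closK => _ _; apply; rewrite // (subv_trans sKL). Qed.
Let abelG : abelian 'Gal(L / K). Proof. by case/and3P: kummerL. Qed.

Lemma mem_eta j : eta j \in 'Gal(L / K)%g.
Proof.
move: dprod_eta; rewrite (bigD1 j) //= => /dprodP[[_ H _ ->] <- _ _].
exact: (subsetP (mulG_subl _ _)) (cycle_id _).
Qed.

(** [#[eta j]] divides the exponent of the Galois group, hence [n], and field embeddings preserve
    the order of a root of unity. *)
Lemma primitive_root_hom (tau : hom_over K Kc) j :
  #[eta j]%g.-primitive_root (root_of_unity tau j).
Proof.
rewrite fmorph_primitive_root.
rewrite (fmorph_primitive_root (tau : 'AHom(subvs_of K, subvs_of Kc))).
apply: dvdn_prim_root => //; have [_ _] := and3P kummerL.
exact/dvdn_trans/dvdn_exponent/mem_eta.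
Qed.

(* If [alpha j = 0] then [compl_field eta j = K], so the other cycles already *)
(* generate the Galois group.                                                 *)
Lemma order_eta_alpha0 j : alpha j = 0 -> #[eta j]%g = 1%N.
Proof.
move=> alpha0; have [a a_root compl_a] := gen_alpha j.
have a0 : a = 0.
  by apply/eqP; move/eqP: a_root; rewrite alpha0 linear0 expf_eq0 => /andP[].
have [H defH tiH] := bigdprod_compl dprod_eta j.
have /(congr1 (fun U => 'Gal(L / U)%g)) := compl_a.
rewrite a0 Fadjoin0 /compl_field /= (bigdprodW defH) gal_fixedField => defG.
apply/eqP; rewrite order_eq1 -cycle_eq1 -tiH.
by rewrite (setIidPl _) // defG cycle_subG mem_eta.
Qed.

Lemma hom_alpha_neq0 (tau : hom_over K Kc) j :
  alpha j != 0 -> vsval (tau (alpha j)) != 0.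
Proof.
by rewrite fmorph_eq0 (fmorph_eq0 (tau : 'AHom(subvs_of K, subvs_of Kc))).
Qed.

Lemma rt_neq0 (tau : hom_over K Kc) j :
  alpha j != 0 -> rt j (vsval (tau (alpha j))) != 0.
Proof.
move/(hom_alpha_neq0 tau); apply: contraNneq => rt0.
by have [_ <-] := root_rt j tau; rewrite rt0 expr0n eqn0Ngt order_gt0.
Qed.

Lemma chi_spec_unique (rho : gal_group Lc 1) (tau : hom_over K Kc) j :
  alpha j != 0 ->
  unique (chi_spec n omega alpha rt rho tau (j := j)) (chi rho tau j).
Proof.
move=> nz_alpha; have prim_w := primitive_root_hom tau j.
pose q := rho (rt j ((rho^-1%g : gal_group Lc 1) (vsval (tau (alpha j)))))
      / rt j (vsval (tau (alpha j))).
have q1 : q ^+ #[eta j]%g = 1.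
  have rhoX (a : M) m : rho a ^+ m = rho (a ^+ m) by rewrite rmorphXn.
  rewrite /q -(val_hom_comp_restr galKc sKcLc) expr_div_n rhoX.
  (* The root in the numerator is the one chosen for the embedding [rho^-1 tau]. *)
  have [_ ->] := root_rt j (hom_comp (restr_gal Kc rho^-1%g) tau).
  have [_ ->] := root_rt j tau.
  rewrite val_hom_comp_restr // gal_groupK ?(subvP sKcLc) ?subvsP //.
  by rewrite divff ?hom_alpha_neq0.
have [c Dc] := prim_rootP prim_w q1.
have uniq_c c' : chi_spec n omega alpha rt rho tau c' -> c = c'.
  move/eqP; rewrite -/q Dc => /esym/eqP.
  by rewrite (eq_prim_root_expr prim_w) !modn_small // => /eqP/val_inj.
have spec_c : chi_spec n omega alpha rt rho tau c by rewrite /chi_spec -Dc.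
rewrite /Defs.chi; case: pickP => [c' spec_c' /= | /(_ c)]; last by rewrite spec_c.
by split=> // c'' /uniq_c <-; apply/esym/uniq_c.
Qed.

Lemma chiP (rho : gal_group Lc 1) (tau : hom_over K Kc) j :
    alpha j != 0 ->
  root_of_unity tau j ^+ chi rho tau j * rt j (vsval (tau (alpha j)))
    = rho (rt j ((rho^-1%g : gal_group Lc 1) (vsval (tau (alpha j))))).
Proof.
move=> nz_alpha; have [/eqP-> _] := chi_spec_unique rho tau nz_alpha.
by rewrite divfK ?rt_neq0.
Qed.

Lemma chiM (x y : gal_group Lc 1) (tau : hom_over K Kc) j :
  chi (x * y)%g tau j =
    chi x tau j + chi y (hom_comp (restr_gal Kc x)^-1%g tau) j
    %[mod #[eta j]%g].
Proof.
have [alpha0 | nz_alpha] := eqVneq (alpha j) 0.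
  (* Here the modulus is [1]. *)
  have all_eq k m : k = m %[mod #[eta j]%g].
    by rewrite (order_eta_alpha0 alpha0) !modn1.
  exact: all_eq.
set tau' := hom_comp _ tau; have prim_w := primitive_root_hom tau j.
apply/eqP; rewrite -(eq_prim_root_expr prim_w) exprD; apply/eqP.
have tau'E u : vsval (tau' u) = (x^-1%g : gal_group Lc 1) (vsval (tau u)).
  by rewrite /tau' -restr_galV // val_hom_comp_restr.
have LcKc (u : subvs_of Kc) : vsval u \in Lc by rewrite (subvP sKcLc) ?subvsP.
have xyVE : ((x * y)^-1%g : gal_group Lc 1) (vsval (tau (alpha j)))
    = (y^-1%g : gal_group Lc 1) (vsval (tau' (alpha j))).
  by rewrite invMg gal_groupM // tau'E.
(* This root must be known to lie in [Lc] before [x * y] can be evaluated on it as a composition. *)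
have [Lrt _] := root_rt j (hom_comp (restr_gal Kc y^-1%g) tau').
rewrite val_hom_comp_restr // in Lrt.
apply: (mulIf (rt_neq0 tau nz_alpha)).
(* Both sides become [x] of the defining equation for [y] at [tau'], because [x] sends the root of
   unity of [tau'] to that of [tau]. *)
rewrite chiP // xyVE gal_groupM // mulrAC chiP // -tau'E -(chiP y tau') //.
by rewrite rmorphM rmorphXn /= !tau'E gal_groupK // mulrC.
Qed.

Lemma kummer_sigmaE (rho : gal_group Lc 1) (tau : hom_over K Kc) :
  gal_group_val (kummer_sigma n omega eta alpha rt rho tau)
    = (\prod_j eta j ^+ chi rho tau j)%g.
Proof.
rewrite /kummer_sigma gal_group_val_prod //; apply: eq_bigr => j _.
by rewrite gal_group_valX /gal_group_val subgK ?mem_eta.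
Qed.

Lemma kummer_phiM : {morph kummer_phi : x y / (x * y)%g}.
Proof.
move=> x y; congr pair; last exact: restr_galM.
apply/ffunP=> tau; rewrite !ffunE /=.
apply: gal_group_val_inj; rewrite gal_group_valM !kummer_sigmaE.
have Geta j m : (eta j ^+ m)%g \in 'Gal(L / K)%g by rewrite groupX ?mem_eta.
rewrite -(abelian_prodgM abelG) //; apply: eq_bigr => j _.
(* [gal_group_valM] reversed the two factors, whence [addnC]. *)
by rewrite -expgD -expg_mod_order chiM expg_mod_order addnC.
Qed.

(** * The kernel *)

Lemma kummer_phi1P (rho : gal_group Lc 1) : kummer_phi rho = 1%g ->
  {in Kc, forall a, rho a = a} /\
  forall (tau : hom_over K Kc) j,
    rho (rt j (vsval (tau (alpha j)))) = rt j (vsval (tau (alpha j))).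
Proof.
case=> /ffunP sigma1 eps1.
have fixKc : {in Kc, forall a, rho a = a}.
  by move=> a Ka; rewrite -(restr_galE rho galKc) // eps1 gal_group1.
split=> // tau j; have [alpha0 | nz_alpha] := eqVneq (alpha j) 0.
  rewrite alpha0 !linear0; have [_] := root_rt j tau.
  by rewrite (order_eta_alpha0 alpha0) alpha0 !linear0 expr1 => ->; rewrite linear0.
have rhoVfix : (rho^-1%g : gal_group Lc 1) (vsval (tau (alpha j)))
    = vsval (tau (alpha j)).
  by rewrite -{1}[vsval _]fixKc ?subvsP // -{2}[rho]invgK gal_groupK
    ?(subvP sKcLc) ?subvsP.
have := chiP rho tau nz_alpha; rewrite rhoVfix => <-.
(* The trivial product of powers of the [eta j] forces every [chi] to be [0]. *)
rewrite (bigdprod_cycle_coord dprod_eta) ?expr0 ?mul1r //.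
rewrite -kummer_sigmaE.
by have := sigma1 tau; rewrite !ffunE => ->.
Qed.

(* An element of ['Gal(L / K)] that fixes [E] lies in the complement of each  *)
(* [<[eta i]>], hence is trivial.                                             *)
Lemma sub_compl_field (E : {subfield M}) :
  (K <= E)%VS -> (forall i, (compl_field eta i <= E)%VS) -> (L <= E)%VS.
Proof.
(* Intersecting with [L] places the question inside the Galois extension [L/K]. *)
move=> sKE sCE; pose E' := (E :&: L)%AS.
have sE'L : (E' <= L)%VS by rewrite capvSr.
have sKE' : (K <= E')%VS by rewrite subv_cap sKE.
have galKL : galois K L by case/and3P: kummerL.
have galE'L : galois E' L by apply: galoisS galKL; rewrite sKE'.
suffices G1 : 'Gal(L / E')%g = 1%g.
  have := galois_fixedField galE'L; rewrite G1 => /= fix1.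
  have: (L <= E')%VS.
    rewrite -[X in (_ <= X)%VS]fix1; apply/subvP=> a La.
    by apply/fixedFieldP=> // x /set1P->; rewrite gal_id.
  by rewrite subv_cap => /andP[].
apply/trivgP/subsetP=> x Gx; apply/set1P.
apply: (bigdprod_cap_compl dprod_eta) => [|i].
  exact: subsetP (galS L sKE') x Gx.
have [H defH _] := bigdprod_compl dprod_eta i.
rewrite (bigdprodW defH).
suff: x \in 'Gal(L / fixedField H)%g by rewrite gal_fixedField.
apply: (subsetP (galS _ _)) Gx; rewrite subv_cap capvSl andbT.
by have := sCE i; rewrite /compl_field /= (bigdprodW defH).
Qed.

Lemma kummer_phi_ker (rho : gal_group Lc 1) :
  kummer_phi rho = 1%g -> rho = 1%g.
Proof.
move/kummer_phi1P => [fixKc fixrt].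
apply: galois_closure_faithful closL _ => g a /=.
pose rho_g := (gal_repr (gal_group_val rho) \o gal_repr (gal_group_val g))%AF.
(* [E] is the equalizer of [rho g] and [g]; being a subfield, it contains [L] once it contains [K]
   and the Kummer generators. *)
pose E := ker_sub_ahom_aspace rho_g (gal_repr (gal_group_val g)).
have memE b : reflect (rho (g b) = g b) (b \in E).
  by apply: (iffP eqlfunP); rewrite /= comp_lfunE.
move=> La; apply/memE; apply: subvP La.
have [tau tauE] := hom_over_restr g galKc sKKc sKcLc.
have sKE : (K <= E)%VS.
  apply/subvP=> u Ku; apply/memE.
  by rewrite -(vsprojK Ku) -tauE fixKc ?subvsP.
apply: sub_compl_field => // i.
have [b b_root ->] := gen_alpha i; apply/FadjoinP; split=> //; apply/memE.
have gX (c : M) m : g c ^+ m = g (c ^+ m) by rewrite rmorphXn.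
have [alpha0 | nz_alpha] := eqVneq (alpha i) 0.
  have -> : b = 0; last by rewrite !linear0.
  by apply/eqP; move/eqP: b_root; rewrite alpha0 linear0 expf_eq0 => /andP[].
have nz_rt := rt_neq0 tau nz_alpha; have [_ rtX] := root_rt i tau.
have q1 : (g b / rt i (vsval (tau (alpha i)))) ^+ #[eta i]%g = 1.
  by rewrite expr_div_n rtX gX b_root -tauE divff ?hom_alpha_neq0.
(* [g b] and the chosen root have the same [#[eta i]]-th power, so they differ by a root of unity in
   [Kc], which [rho] fixes. *)
have [k /(canRL (divfK nz_rt)) ->] := prim_rootP (primitive_root_hom tau i) q1.
by rewrite rmorphM rmorphXn /= fixrt fixKc ?subvsP.
Qed.

End KummerEmbedding.

Theorem theorem1p11 (F : fieldType) (M : splittingFieldType F)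
    (K L Kc Lc : {subfield M}) (n r : nat) (omega : subvs_of K)
    (eta : 'I_r -> gal_of L) (alpha : 'I_r -> subvs_of K)
    (rt : 'I_r -> M -> M)
    (sKL : (K <= L)%VS)
    (sepL : separable 1 L)
    (closK : is_galois_closure K Kc)
    (closL : is_galois_closure L Lc)
    (prim_omega : n.-primitive_root omega)
    (kummerL : kummer_ext n K L)
    (dprod_eta : \big[dprod/1%g]_(i < r) <[eta i]>%g = 'Gal(L / K)%g)
    (gen_alpha : forall i : 'I_r, exists2 a : M,
        a ^+ #[eta i]%g = vsval (alpha i) &
        compl_field eta i = <<K; a>>%VS :> {vspace M})
    (gal_alpha : forall i : 'I_r,
        'Gal(compl_field eta i / K)%g =
          <[normalField_cast (compl_field eta i) (eta i)]>%g)
    (root_rt : forall (j : 'I_r) (tau : hom_over K Kc),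
        rt j (vsval (tau (alpha j))) \in Lc /\
        rt j (vsval (tau (alpha j))) ^+ #[eta j]%g = vsval (tau (alpha j))) :
  let phi : gal_group Lc 1 -> wreath (gal_group L K) (hom_action K Kc) :=
    kummer_phi n omega eta alpha rt in
  [/\ forall (rho : gal_group Lc 1) (tau : hom_over K Kc) (j : 'I_r),
        alpha j != 0 ->
        unique (chi_spec n omega alpha rt rho tau (j := j))
               (chi n omega eta alpha rt rho tau j),
      {morph phi : rho1 rho2 / (rho1 * rho2)%g},
      injective phi
    & exists G : {group wreath (gal_group L K) (hom_action K Kc)},
        ([set: gal_group Lc 1] \isog G)%g].
Proof.
move=> phi; have phiM : {morph phi : x y / (x * y)%g} by exact: kummer_phiM.
have phi_inj : injective phi.
  move=> x y eq_xy; apply: (mulIg y^-1%g); rewrite mulgV.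
  apply: (kummer_phi_ker sKL closK closL prim_omega kummerL dprod_eta gen_alpha
    root_rt).
  have phi1 : phi 1%g = 1%g by apply: (mulgI (phi 1%g)); rewrite -phiM !mulg1.
  by rewrite -[LHS]/(phi _) phiM eq_xy -phiM mulgV.
pose f := Morphism (D := [set: gal_group Lc 1]) (in2W phiM).
split=> //; first by move=> rho tau j; exact: chi_spec_unique.
exists (f @* [set: gal_group Lc 1])%G.
by rewrite sub_isog //; apply/injmP=> x y _ _; exact: phi_inj.
Qed.
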